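(* Let $K$ be a compact line and $Q$ a subset of $K$. If $Q$, endowed with the topology induced by $K$, admits a countably separating family, then every weak*-null family $(F_i)_{i\in I}$ in $\mathrm{NBV}(K)$ is of type $c_0\ell_1$ over $Q$.
   Context: A compact line is a totally ordered set which is compact in its order topology. $\mathrm{NBV}(K)$ is the space of right-continuous real maps of bounded variation on $K$, identified with $C(K)^*$ via $F_\mu(t)=\mu([\min K,t])$. $\lim_{i\in I}a_i=0$ means $\{i:|a_i|\ge\varepsilon\}$ is finite for every $\varepsilon>0$. A family $(F_i)_{i\in I}$ in $\mathrm{NBV}(K)$ is weak*-null if $\lim_{i\in I}\int_Kf\,d\mu_i=0$ for every $f\in C(K)$, $\mu_i$ being the measure associated to $F_i$. $(F_i)$ is of type $c_0\ell_1$ over $Q$ if $F_i(t)=a_{i,t}+b_{i,t}$ ($i\in I$, $t\in Q$) with $\lim_{i\in I}a_{i,t}=0$ for each $t\in Q$ and $\sup_{i}\sum_{t\in Q}|b_{i,t}|<\infty$. A countably separating family for a topological space $X$ is a family $(V_x)_{x\in X}$ with $V_x$ a neighborhood of $x$ for each $x$, such that every subset $M\subseteq X$ satisfying $x\in V_y$ for all $x,y\in M$ is countable. *)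

(* Defs.v *)
From HB Require Import structures.
From mathcomp Require Import all_boot all_order all_algebra.
From mathcomp Require Import all_classical all_reals all_analysis.
Set Implicit Arguments. Unset Strict Implicit. Unset Printing Implicit Defensive.
Import Order.TTheory GRing.Theory Num.Theory numFieldNormedType.Exports.
Local Open Scope classical_set_scope.
Local Open Scope ring_scope.

(* The Borel sigma-algebra of the topological space K (generated by its open
   sets).  The measurable-type structure of mathcomp-analysis needs a pointed
   carrier, so we use the alias [pointedK x0] of K, pointed by some x0 : K
   (a compact line is nonempty since it has a minimum). The sigma-algebra
   does not depend on x0. *)
Section pointed_alias.
Context {d : Order.disp_t} (K : orderTopologicalType d) (x0 : K).
Definition pointedK (_ : K) : Type := K.
HB.instance Definition _ := Choice.copy (pointedK x0) K.
HB.instance Definition _ := isPointed.Build (pointedK x0) x0.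
Definition borelK : Type := g_sigma_algebraType (@open K : set (set (pointedK x0))).
HB.instance Definition _ := Measurable.copy borelK
  (g_sigma_algebraType (@open K : set (set (pointedK x0)))).
End pointed_alias.

Section defs.
Context {d : Order.disp_t} (K : orderTopologicalType d) (x0 : K) (R : realType).
Local Notation borel := (borelK x0).

Definition regular_measure (mu : {measure set (borel) -> \bar R}) : Prop :=
  forall A : set (borel), measurable A ->
    mu A = ereal_inf [set mu U | U in [set U : set K | open U /\ A `<=` U]] /\
    mu A = ereal_sup [set mu C | C in [set C : set K | compact C /\ C `<=` A]].

(* A regular signed Borel measure is represented as mup - mun with
   mup, mun finite regular (positive) Borel measures. *)
Definition sintegral (mup mun : {finite_measure set (borel) -> \bar R})
  (f : K -> R) : R :=
  fine (\int[mup]_x (f x)%:E) - fine (\int[mun]_x (f x)%:E).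

Definition Fdist (mup mun : {finite_measure set (borel) -> \bar R}) (t : K) : R :=
  fine (mup [set x : K | (x <= t)%O]) - fine (mun [set x : K | (x <= t)%O]).

Definition lim0 (I : Type) (a : I -> R) : Prop :=
  forall e : R, 0 < e -> finite_set [set i | e <= `|a i|].

Definition weak_star_null (I : Type)
  (mup mun : I -> {finite_measure set (borel) -> \bar R}) : Prop :=
  forall f : K -> R, continuous f -> lim0 (fun i => sintegral (mup i) (mun i) f).

Definition type_c0l1 (I : Type) (Q : set K) (F : I -> K -> R) : Prop :=
  exists a b : I -> K -> R,
    (forall i t, Q t -> F i t = a i t + b i t) /\
    (forall t, Q t -> lim0 (fun i => a i t)) /\
    exists C : R, forall i, (\esum_(t in Q) (`|b i t|)%:E <= C%:E)%E.

(* (V x)_{x in Q} is a countably separating family for Q with the topology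
   induced by K: each V x is a neighbourhood of x in the subspace Q. *)
Definition countably_separating_on (Q : set K) (V : K -> set K) : Prop :=
  (forall x, Q x -> V x `<=` Q /\ exists W, nbhs x W /\ W `&` Q `<=` V x) /\
  (forall M : set K, M `<=` Q -> (forall x y, M x -> M y -> V y x) -> countable M).

End defs.

(* Main.v *)
(* The decomposition is of the form [b = F] on a relation [S] between [I] and [Q],
   [b = 0] off [S], and [a = F - b].  Let [mu_i] be the functional of index [i];
   by uniform boundedness their norms are at most some [C].
   For fixed [i], the points [t] of [Q] where [F_i t] is not controlled by the
   integrals of two continuous steps adapted to the neighbourhood [V_t] form a set
   [B_i], and countable separation makes [B_i] countable.
   Call [X] saturated if any two points [x < y] of [X] are separated by a continuous
   step that is annihilated by every [mu_i] with [B_i] not included in [X].  For such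
   an [i], the sum of [|F_i t|] over [X] is at most [2 C], whatever part of [{i} x X]
   belongs to [S]; if on the other hand [B_i] is included in [X], the values [F_i t]
   with [t] outside [X] may go into [a].  Every saturated set extends to a larger one
   by a countable set, on which a diagonal argument produces [S]; since [S] is never
   changed on [X], the constant [3 C + 1] survives unions of chains, and Zorn's lemma
   exhausts [Q]. *)
Require Import Defs.
From HB Require Import structures.
From mathcomp Require Import all_boot all_order all_algebra.
From mathcomp Require Import all_classical all_reals all_analysis.
From mathcomp Require Import measurable_realfun ring lra.
Import Order.TTheory GRing.Theory Num.Theory numFieldNormedType.Exports.
Local Open Scope classical_set_scope.
Local Open Scope ring_scope.

(** * Continuous steps on a compact line *)

Definition unit_fun {T : topologicalType} {R : realType} (f : T -> R) :=
  continuous f /\ forall z, 0 <= f z <= 1.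

Section steps.
Context {d : Order.disp_t} {K : orderTopologicalType d} {R : realType}.
Implicit Types (f : K -> R) (x y t : K).

Definition one_upto f x := forall z, (z <= x)%O -> f z = 1.
Definition zero_from f y := forall z, (y <= z)%O -> f z = 0.

Lemma unit_fun_cst (c : R) : 0 <= c <= 1 -> unit_fun (fun _ : K => c).
Proof. by move=> c01; split => // z; exact: cvg_cst. Qed.

(** A compact Hausdorff space is normal, so Urysohn's lemma separates the two disjoint closed
    rays. *)
Lemma step_exists (hK : compact [set: K]) x y : (x < y)%O ->
  exists f, [/\ unit_fun f, one_upto f x & zero_from f y].
Proof.
move=> xy.
have nK : normal_space K by apply: compact_normal => //; exact: order_hausdorff.
have /(@normal_separatorP R) sep := nK.
have : uniform_separator `[y, +oo[%classic `]-oo, x]%classic.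
  apply: sep; [exact: rray_closed|exact: lray_closed|].
  rewrite -subset0 => z []; rewrite /= !in_itv /= andbT => yz zx.
  by have := lt_le_trans xy (le_trans yz zx); rewrite ltxx.
move/(@uniform_separatorP _ R) => [f [cf f01 f0 f1]].
exists f; split.
- split => // z; have : range f (f z) by exists z.
  by move/f01; rewrite /= in_itv.
- move=> z zx; apply: (imsub1 f1); by rewrite /= in_itv.
- move=> z yz; apply: (imsub1 f0); by rewrite /= in_itv /= yz.
Qed.

(** [W] contains an open interval around [t]. If its left end is a point [u], every [y < t] outside
    [W] satisfies [y <= u], and a step from [u] to [t] works. If it is unbounded on the left, no
    such [y] exists and the zero function serves. *)
Lemma left_step (hK : compact [set: K]) t (W : set K) : nbhs t W ->
  exists f, [/\ unit_fun f, zero_from f t &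
    forall y, (y < t)%O -> ~ W y -> one_upto f y].
Proof.
rewrite itv_nbhsE => -[[[[] u|[]] r] [ope tin] sub].
- by move: ope; case: r {tin sub} => [[]|[]].
- have ut : (u < t)%O by move: tin; rewrite itv_boundlr => /andP[].
  have [f [uf f1 f0]] := step_exists hK u t ut.
  exists f; split => // y yt nWy z zy; apply: f1; apply: (le_trans zy).
  rewrite leNgt; apply/negP => uy; apply: nWy; apply: sub => /=.
  move: tin; rewrite !itv_boundlr => /andP[_ tr]; apply/andP; split => //.
  by apply: le_trans tr; rewrite bnd_simp ltW.
- exists (fun=> 0); split.
  + by apply: unit_fun_cst; rewrite lexx ler01.
  + by [].
  + move=> y yt nWy; case: nWy; apply: sub => /=.
    move: tin; rewrite !itv_boundlr => /andP[_ tr]; apply/andP; split => //.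
    by apply: le_trans tr; rewrite bnd_simp ltW.
- by move: tin; rewrite itv_boundlr => /andP[].
Qed.

Lemma right_step (hK : compact [set: K]) t (W : set K) : nbhs t W ->
  exists f, [/\ unit_fun f, one_upto f t &
    forall y, (t < y)%O -> ~ W y -> zero_from f y].
Proof.
rewrite itv_nbhsE => -[[l [[] v|[]]] [ope tin] sub].
- have tv : (t < v)%O by move: tin; rewrite itv_boundlr => /andP[].
  have [f [uf f1 f0]] := step_exists hK t v tv.
  exists f; split => // y yt nWy z zy; apply: f0; apply: le_trans zy.
  rewrite leNgt; apply/negP => uy; apply: nWy; apply: sub => /=.
  move: tin; rewrite !itv_boundlr => /andP[lt _]; apply/andP; split => //.
  by apply: (le_trans lt); rewrite bnd_simp ltW.
- by move: ope; case: l {tin sub} => [[]|[]].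
- by move: tin; rewrite itv_boundlr => /andP[].
- exists (fun=> 1); split.
  + by apply: unit_fun_cst; rewrite lexx ler01.
  + by [].
  + move=> y yt nWy; case: nWy; apply: sub => /=.
    move: tin; rewrite !itv_boundlr => /andP[lt _]; apply/andP; split => //.
    by apply: (le_trans lt); rewrite bnd_simp ltW.
Qed.

End steps.

(** * Uniform boundedness *)

Section uniform_boundedness.
Context {T : topologicalType} {R : realType}.
Implicit Types f g : T -> R.

(** The increments are bounded by [c / 3 ^+ n - c / 3 ^+ n.+1], which telescopes. Hence every lower
    estimate [f_ n x - c / 3 ^+ n] lies below every upper estimate [f_ m x + c / 3 ^+ m], and the
    supremum of the lower ones is the limit. *)
Lemma uniform_limit_exists (f_ : nat -> T -> R) (c : R) : 0 <= c ->
  (forall n, continuous (f_ n)) ->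
  (forall n x, `|f_ n.+1 x - f_ n x| <= 2 * c / 3 ^+ n.+1) ->
  exists f, continuous f /\ forall n x, `|f x - f_ n x| <= c / 3 ^+ n.
Proof.
move=> c0 cf fS.
have cS n : c / 3 ^+ n = 2 * c / 3 ^+ n.+1 + c / 3 ^+ n.+1.
  have : (3 : R) ^+ n != 0 by rewrite expf_neq0// pnatr_eq0.
  by rewrite exprS => h; field.
have c_ge0 n : 0 <= c / 3 ^+ n by rewrite divr_ge0 ?exprn_ge0.
have near n k x : `|f_ (n + k)%N x - f_ n x| <= c / 3 ^+ n - c / 3 ^+ (n + k)%N.
  elim: k => [|k IH]; first by rewrite addn0 !subrr normr0.
  rewrite addnS; move: IH (fS (n + k)%N x); rewrite (cS (n + k)%N).
  by rewrite !ler_norml => /andP[? ?] /andP[? ?]; apply/andP; split; lra.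
have lu n m x : f_ n x - c / 3 ^+ n <= f_ m x + c / 3 ^+ m.
  have [nm|/ltnW mn] := leqP n m.
    have := near n (m - n)%N x; rewrite subnKC// ler_norml => /andP[? ?].
    by have := c_ge0 m; lra.
  have := near m (n - m)%N x; rewrite subnKC// ler_norml => /andP[? ?].
  by have := c_ge0 n; lra.
pose f x := sup (range (fun n => f_ n x - c / 3 ^+ n)).
have fP n x : `|f x - f_ n x| <= c / 3 ^+ n.
  have hs : has_sup (range (fun n => f_ n x - c / 3 ^+ n)).
    split; first by exists (f_ 0 x - c / 3 ^+ 0); exists 0%N.
    by exists (f_ 0 x + c / 3 ^+ 0) => _ [m _ <-]; exact: lu.
  have h1 : f_ n x - c / 3 ^+ n <= f x.
    by apply: ub_le_sup; [case: hs|exists n].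
  have h2 : f x <= f_ n x + c / 3 ^+ n.
    by apply: ge_sup; [case: hs|move=> _ [m _ <-]; exact: lu].
  by rewrite ler_norml; apply/andP; split; lra.
exists f; split => // x; apply/(@cvgrPdist_le _ R^o) => e e0.
have [n hn] : exists n, c / 3 ^+ n <= e / 3.
  have /(@cvgrPdist_le _ R^o) /(_ (e / 3)) : (geometric c (3^-1 : R)) @ \oo --> (0 : R).
    by apply: cvg_geometric; rewrite ger0_norm ?invf_lt1 ?ltr1n.
  case=> [|n _ /(_ n (leqnn n))]; first by rewrite divr_gt0.
  rewrite /= sub0r normrN /geometric /= exprVn => h; exists n.
  by apply: le_trans h; exact: ler_norm.
have e3 : 0 < e / 3 by rewrite divr_gt0.
have /(@cvgrPdist_le _ R^o) /(_ _ e3) := cf n x.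
apply: filterS => y hy; move: hy (fP n x) (fP n y).
rewrite !ler_norml => /andP[? ?] /andP[? ?] /andP[? ?]; apply/andP; split; lra.
Qed.

(* Gliding hump (after Sokal): for a linear [L], one of [f + h], [f - h] has an
   image of size at least [|L h|], so no Baire category argument is needed. *)
Lemma uniform_boundedness (I : Type) (L : I -> (T -> R) -> R) :
  (forall i f g c, continuous f -> continuous g ->
    L i (fun x => f x + c * g x) = L i f + c * L i g) ->
  (forall i, exists M, forall f, continuous f -> (forall x, `|f x| <= 1) ->
    `|L i f| <= M) ->
  (forall f, continuous f -> exists M, forall i, `|L i f| <= M) ->
  exists C, 0 <= C /\ forall i f, continuous f -> (forall x, `|f x| <= 1) ->
    `|L i f| <= C.
Proof.
move=> Llin Lbd Lpt; apply: contrapT => nC.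
(* If no uniform bound exists, some functional is large at a [g] of the unit ball which nearly
   attains its norm: [g] is chosen to reach more than two thirds of the supremum [sup A]. *)
have big c : 0 <= c -> exists ig : I * (T -> R), [/\ continuous ig.2,
    forall x, `|ig.2 x| <= 1, c < `|L ig.1 ig.2| &
    forall f, continuous f -> (forall x, `|f x| <= 1) ->
      `|L ig.1 f| <= 3 / 2 * `|L ig.1 ig.2|].
  move=> c0.
  have [i [f [cf f1 cL]]] : exists i f, [/\ continuous f,
      forall x, `|f x| <= 1 & 3 / 2 * c + 1 < `|L i f|].
    apply: contrapT => h; apply: nC; exists (3 / 2 * c + 1); split; first by lra.
    move=> i f cf f1.
    by rewrite leNgt; apply/negP => lt; apply: h; exists i, f.
  pose A := [set `|L i g| | g in [set g | continuous g /\ forall x, `|g x| <= 1]].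
  have [M LM] := Lbd i.
  have hA : has_sup A.
    split; first by exists `|L i f|; exists f.
    by exists M => _ [g [cg g1] <-]; exact: LM.
  have Af : `|L i f| <= sup A by apply: ub_le_sup; [case: hA|exists f].
  have e0 : 0 < sup A / 3 by lra.
  have [_ [g [cg g1] <-] hg] := sup_adherent e0 hA.
  exists (i, g); split => //=; first lra.
  move=> h ch h1; have : `|L i h| <= sup A by apply: ub_le_sup; [case: hA|exists h].
  lra.
have pos n : 0 <= 8 * n%:R * 3 ^+ n :> R.
  by rewrite mulr_ge0 ?mulr_ge0 ?exprn_ge0.
pose ig n := projT1 (cid (big _ (pos n))).
have igP n := projT2 (cid (big _ (pos n))).
pose hump n x := 3^- n * (ig n).2 x.
(* The sign with which the hump is added, so that the functional of stage [n] does not lose the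
   contribution of its own hump. *)
pose s n f : R := if `|L (ig n).1 (hump n)| <= `|L (ig n).1 (fun x => f x + 1 * hump n x)|
  then 1 else -1.
pose f_ := fix f_ n : T -> R := if n is m.+1 then fun x => f_ m x + s m (f_ m) * hump m x
  else fun=> 0.
have chump n : continuous (hump n).
  move=> x; apply: (@continuousM R T (cst (3^- n)) (ig n).2); first exact: cvg_cst.
  by have [+ _ _ _] := igP n; exact.
have cf n : continuous (f_ n).
  elim: n => [|n IH] x /=; first exact: cvg_cst.
  apply: (@continuousD R R^o T (f_ n)); first exact: IH.
  by apply: (@continuousM R T (cst _) (hump n)); [exact: cvg_cst|exact: chump].
have normhump n x : `|hump n x| <= 3^- n.
  rewrite normrM ger0_norm; last by rewrite invr_ge0 exprn_ge0.
  have [_ /(_ x) h _ _] := igP n.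
  by rewrite -[leRHS]mulr1 ler_wpM2l// invr_ge0 exprn_ge0.
have norms n f : `|s n f| = 1 by rewrite /s; case: ifP; rewrite ?normrN normr1.
(* The increments [3^- n] equal [2 * c / 3 ^+ n.+1] for [c = 3 / 2]. *)
have [|n x|f [cfl flim]] := uniform_limit_exists f_ (3 / 2) _ cf.
- by [].
- rewrite /= addrC addKr normrM norms mul1r (le_trans (normhump _ _))//.
  have : (3 : R) ^+ n != 0 by rewrite expf_neq0// pnatr_eq0.
  rewrite exprS => h; rewrite (_ : 2 * (3 / 2) / (3 * 3 ^+ n) = 3^- n)//.
  by field.
have [M LM] := Lpt _ cfl.
have [n Mn] : exists n, M < n%:R by exists (Num.truncn M).+1; exact: truncnS_gt.
have [cg g1 gbig gmax] := igP n; rewrite -/(ig n) in cg g1 gbig gmax.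
set i := (ig n).1 in gbig gmax; set g := (ig n).2 in cg g1 gbig gmax.
have L0 : L i (fun=> 0) = 0.
  have : L i (fun=> 0) = L i (fun=> 0) + 1 * L i (fun=> 0).
    rewrite -Llin; [|by move=> x; exact: cvg_cst..].
    by congr (L i _); apply/funext => x; rewrite mulr0 addr0.
  by rewrite mul1r => /esym/(canRL (addrK _)); rewrite subrr.
have LZ (c : R) (h : T -> R) : continuous h -> L i (fun x => c * h x) = c * L i h.
  move=> ch; rewrite -[RHS]add0r -{1}L0 -Llin//; last by move=> x; exact: cvg_cst.
  by congr (L i _); apply/funext => x; rewrite add0r.
have humpE : L i (hump n) = 3^- n * L i g by exact: LZ.
have LfS : `|L i (hump n)| <= `|L i (f_ n.+1)|.
  rewrite /= /s -/i; case: ifPn => [//|].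
  rewrite -ltNge !Llin// !mul1r mulN1r => lt.
  have := ler_normB (L i (f_ n) + L i (hump n)) (L i (f_ n) - L i (hump n)).
  rewrite (_ : _ - (_ - _) = L i (hump n) *+ 2); last by ring.
  rewrite normrMn; lra.
(* The tail after stage [n] is at most [(3 / 2) / 3 ^+ n.+1], the inverse of [2 * 3 ^+ n]. Rescaled,
   it lies in the unit ball, where [L i] is at most [3 / 2] times its size at [g]. *)
pose r x := 2 * 3 ^+ n * (f x - f_ n.+1 x).
have cr : continuous r.
  move=> x; apply: (@continuousM R T (cst _)); first exact: cvg_cst.
  by apply: (@continuousB R R^o T); [exact: cfl|exact: cf].
have p3 : 0 < (3 : R) ^+ n by rewrite exprn_gt0.
have r1 x : `|r x| <= 1.
  have c0 : 0 <= 2 * 3 ^+ n :> R by rewrite mulr_ge0// ltW.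
  have := flim n.+1 x; rewrite normrM (ger0_norm c0) => /(ler_wpM2l c0)/le_trans; apply.
  suff -> : 2 * 3 ^+ n * (3 / 2 / 3 ^+ n.+1) = 1 :> R by [].
  by rewrite exprS; have := lt0r_neq0 p3 => ?; field.
have Lf : L i f = L i (f_ n.+1) + (2 * 3 ^+ n)^-1 * L i r.
  rewrite -Llin//; congr (L i _); apply/funext => x.
  by rewrite /r mulKf ?subrKC// lt0r_neq0// mulr_gt0.
have := LM i; rewrite Lf => le.
have := gmax _ cr r1 => rle.
move: LfS; rewrite humpE normrM gtr0_norm ?invr_gt0// => LfS.
have : 3^- n * `|L i g| - (2 * 3 ^+ n)^-1 * (3 / 2 * `|L i g|) <= M.
  have := lerB_normD (L i (f_ n.+1)) ((2 * 3 ^+ n)^-1 * L i r).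
  rewrite normrM (@ger0_norm _ (2 * 3 ^+ n)^-1) ?invr_ge0 ?mulr_ge0 ?(ltW p3)//.
  have : (2 * 3 ^+ n)^-1 * `|L i r| <= (2 * 3 ^+ n)^-1 * (3 / 2 * `|L i g|).
    by rewrite ler_wpM2l// invr_ge0 mulr_ge0 // ltW.
  lra.
(* The tail cancels at most three quarters of the hump. The remaining quarter exceeds [2 * n%:R] by
   the choice of [8 * n%:R * 3 ^+ n], whereas [M < n%:R]. *)
have -> : 3^- n * `|L i g| - (2 * 3 ^+ n)^-1 * (3 / 2 * `|L i g|)
    = `|L i g| / (4 * 3 ^+ n).
  by have := lt0r_neq0 p3 => ?; field.
rewrite ler_pdivrMr ?mulr_gt0//; apply/negP; rewrite -ltNge.
apply: le_lt_trans gbig.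
have -> : 8 * n%:R * 3 ^+ n = (2 * n%:R) * (4 * 3 ^+ n) :> R by ring.
by rewrite ler_pM2r ?mulr_gt0//; have : 0 <= n%:R :> R by []; lra.
Qed.

End uniform_boundedness.

(** * Functionals given by regular measures *)

Lemma Rintegral_indic_dist d (T : measurableType d) (R : realType)
    (mu : {finite_measure set T -> \bar R}) (A S : set T) (g : T -> R) :
  measurable A -> measurable S -> measurable_fun setT g ->
  (forall x, `|g x - \1_A x| <= \1_S x) ->
  `|\int[mu]_x g x - fine (mu A)| <= fine (mu S).
Proof.
move=> mA mS mg gA.
have iA := integrable_indic mu mA; have iS := integrable_indic mu mS.
have ig : mu.-integrable setT (EFin \o g).
  (* [g] is bounded by [\1_A + \1_S], hence by 2. *)
  apply: (@le_integrable _ _ _ mu _ measurableT _ (cst 2%:E)).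
  - exact/measurable_EFinP.
  - move=> x _; rewrite /= lee_fin; have := gA x.
    have : \1_A x <= 1 :> R by rewrite indicE; case: (_ \in _).
    have : \1_S x <= 1 :> R by rewrite indicE; case: (_ \in _).
    have : 0 <= \1_A x :> R by [].
    rewrite (ger0_norm (ler0n R 2)) !ler_norml => ? ? ? /andP[? ?].
    by apply/andP; split; lra.
  - exact: finite_measure_integrable_cst.
have indicI B : measurable B -> fine (mu B) = \int[mu]_x \1_B x.
  by move=> mB; rewrite /Rintegral integral_indic// setIT.
rewrite !indicI// -RintegralB//; apply: le_trans (le_normr_Rintegral _ _) _ => //.
  exact: (integrableB measurableT ig iA).
apply: le_Rintegral => //.
- apply: (le_integrable measurableT _ _ iS).
    apply/measurable_EFinP; apply: measurableT_comp => //.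
    exact: measurable_funB.
  by move=> x _; rewrite /= lee_fin normr_id (le_trans (gA x))// ler_norm.
Qed.

Section borel.
Context {d : Order.disp_t} {K : orderTopologicalType d} (x0 : K) {R : realType}.
Implicit Types (f : K -> R) (mu mup mun : {finite_measure set (borelK x0) -> \bar R}).

Lemma open_borel (U : set K) : open U -> measurable (U : set (borelK x0)).
Proof. exact: sub_sigma_algebra. Qed.

Lemma ray_borel (t : K) : measurable ([set x : K | (x <= t)%O] : set (borelK x0)).
Proof.
rewrite -[X in measurable X]setCK; apply: measurableC; apply: open_borel.
rewrite openC (_ : [set x : K | (x <= t)%O] = `]-oo, t]%classic).
  exact: lray_closed.
by apply/seteqP; split => x; rewrite /= in_itv.
Qed.

Lemma continuous_borel f : continuous f -> measurable_fun setT (f : borelK x0 -> R).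
Proof.
move=> /continuousP cf _; apply: (measurability _ (RGenOInfty.measurableE R)) => //.
move=> _ [_ [x ->] <-]; rewrite setTI; apply: open_borel; apply: cf.
exact: interval_open.
Qed.

Lemma continuous_integrable (hK : compact [set: K]) mu f : continuous f ->
  mu.-integrable setT (EFin \o (f : borelK x0 -> R)).
Proof.
move=> cf; apply: measurable_bounded_integrable => //.
- by rewrite -ge0_fin_numE ?fin_num_measure.
- exact: continuous_borel.
- have /compact_bounded : compact (f @` setT).
    by apply: continuous_compact => //; exact: continuous_subspaceT.
  move=> [M [Mr hM]]; exists M; split => // y My x _.
  by apply: hM => //; exists x.
Qed.

Lemma sintegral_linear (hK : compact [set: K]) mup mun f (g : K -> R) (c : R) :
  continuous f -> continuous g ->
  Defs.sintegral mup mun (fun x => f x + c * g x) =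
    Defs.sintegral mup mun f + c * Defs.sintegral mup mun g.
Proof.
move=> cf cg.
have one mu : fine (\int[mu]_x (f x + c * g x)%:E) =
    fine (\int[mu]_x (f x)%:E) + c * fine (\int[mu]_x (g x)%:E).
  have If := continuous_integrable hK mu _ cf.
  have Ig := continuous_integrable hK mu _ cg.
  have := @RintegralD _ _ _ mu setT f (fun x => c * g x) measurableT If.
  rewrite /Rintegral => ->; last exact: (integrableZl measurableT c Ig).
  by congr (_ + _); exact: (@RintegralZl _ _ _ mu setT g c measurableT Ig).
by rewrite /Defs.sintegral !one; ring.
Qed.

Lemma sintegral_bounded (hK : compact [set: K]) mup mun : exists M, forall f,
  continuous f -> (forall x, `|f x| <= 1) -> `|Defs.sintegral mup mun f| <= M.
Proof.
exists (fine (mup setT) + fine (mun setT)) => f cf f1.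
have one mu : `|fine (\int[mu]_x (f x)%:E)| <= fine (mu setT).
  have := @Rintegral_indic_dist _ _ _ mu set0 setT f measurable0 measurableT
    (continuous_borel _ cf).
  rewrite measure0 subr0; apply => x.
  by rewrite !indicE in_set0 in_setT subr0.
by apply: le_trans (ler_normB _ _) _; exact: lerD.
Qed.

Lemma Fdist_dist mup mun f (t : K) (S : set K) : continuous f ->
  measurable (S : set (borelK x0)) ->
  (forall x, `|f x - (x <= t)%O%:R| <= \1_S x) ->
  `|Fdist mup mun t - Defs.sintegral mup mun f| <= fine (mup S) + fine (mun S).
Proof.
move=> cf mS h.
have one mu : `|fine (mu [set x : K | (x <= t)%O]) - fine (\int[mu]_x (f x)%:E)|
    <= fine (mu S).
  rewrite distrC.
  apply: (@Rintegral_indic_dist _ _ _ mu [set x : K | (x <= t)%O] S f (ray_borel t) mS).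
    exact: continuous_borel.
  by move=> x; rewrite [\1_[set _ | _] x]indicE mem_setE; exact: h.
by rewrite /Fdist /Defs.sintegral opprD addrACA -opprD (le_trans (ler_normB _ _))// lerD.
Qed.

(** [G] is the distribution function of [mup + mun], so [G y - G x] is the mass of the interval from
    [x] to [y] without [x]. Off this interval a step from [x] to [y] agrees with the indicators of
    both rays, the one up to [x] and the one up to [y]. *)
Lemma Fdist_approx_interval mup mun : exists G : K -> R,
  [/\ forall t, 0 <= G t,
   forall x y f, (x <= y)%O -> unit_fun f -> one_upto f x -> zero_from f y ->
    `|Fdist mup mun x - Defs.sintegral mup mun f| <= G y - G x &
   forall x y f, (x <= y)%O -> unit_fun f -> one_upto f x -> zero_from f y ->
    `|Fdist mup mun y - Defs.sintegral mup mun f| <= G y - G x].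
Proof.
pose ray (t : K) : set K := [set x : K | (x <= t)%O].
pose G t := fine (mup (ray t)) + fine (mun (ray t)).
have mray t : measurable (ray t : set (borelK x0)) by exact: ray_borel.
have GB x y : (x <= y)%O ->
    fine (mup (ray y `\` ray x)) + fine (mun (ray y `\` ray x)) = G y - G x.
  move=> xy; rewrite /G.
  have sub : ray x `<=` ray y by move=> z /= zx; exact: le_trans xy.
  have one mu : fine (mu (ray y `\` ray x)) = fine (mu (ray y)) - fine (mu (ray x)).
    rewrite measureD//; last by rewrite -ge0_fin_numE ?fin_num_measure.
    by rewrite (setIidr sub) fineB//; exact: fin_num_measure.
  by rewrite !one; ring.
exists G; split.
- by move=> t; rewrite addr_ge0// fine_ge0.
- move=> x y f xy [cf f01] f1 f0; rewrite -GB//; apply: Fdist_dist => //.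
    exact: measurableD.
  move=> z; case: (leP z x) => zx; first by rewrite f1// subrr normr0.
  case: (leP z y) => zy; last by rewrite f0 ?subrr ?normr0// ltW.
  rewrite indicE mem_set; last by split => //; rewrite /ray /= leNgt zx.
  by rewrite subr0; have /andP[? ?] := f01 z; rewrite ger0_norm.
- move=> x y f xy [cf f01] f1 f0; rewrite -GB//; apply: Fdist_dist => //.
    exact: measurableD.
  move=> z; case: (leP z x) => zx; first by rewrite f1// (le_trans zx xy) subrr normr0.
  case: (leP z y) => zy; last by rewrite f0 ?subrr ?normr0// ltW.
  rewrite indicE mem_set; last by split => //; rewrite /ray /= leNgt zx.
  rewrite -[true%:R]/(1 : R).
  by have /andP[? ?] := f01 z; rewrite ler_norml; apply/andP; split; lra.
Qed.

Lemma regular_outer mu (A : set K) (e : R) : regular_measure mu ->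
  measurable (A : set (borelK x0)) -> 0 < e ->
  exists U : set K, [/\ open U, A `<=` U & fine (mu (U `\` A)) <= e].
Proof.
move=> reg mA e0; have [infA _] := reg _ mA.
have finA := fin_num_measure mu _ mA.
have := @lb_ereal_inf_adherent _ _ e e0; move: (finA); rewrite {1}infA => fi /(_ _ fi).
rewrite -infA => -[_ [U [oU AU] <-] lt]; exists U; split => //.
have mU := open_borel _ oU.
rewrite measureD//; last by rewrite -ge0_fin_numE ?fin_num_measure.
rewrite (setIidr AU) fineB//; last exact: fin_num_measure.
rewrite lerBlDl -lee_fin EFinD !fineK//; [exact: ltW|exact: fin_num_measure].
Qed.

Lemma Fdist_approx_step (hK : compact [set: K]) mup mun (t : K) (s : seq K) (e : R) :
  regular_measure mup -> regular_measure mun -> 0 < e ->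
  exists f, [/\ unit_fun f, one_upto f t,
    forall y, y \in s -> (t < y)%O -> zero_from f y &
    `|Fdist mup mun t - Defs.sintegral mup mun f| <= e].
Proof.
move=> rp rn e0; have e2 : 0 < e / 2 by rewrite divr_gt0.
pose A := [set x : K | (x <= t)%O].
have mA : measurable (A : set (borelK x0)) by exact: ray_borel.
have [U [oU AU Ue]] := regular_outer _ _ _ rp mA e2.
have [V [oV AV Ve]] := regular_outer _ _ _ rn mA e2.
(* A neighbourhood of [t] inside both outer approximations of the ray that misses every point of [s]
   beyond [t]. A step vanishing from each point on the right outside [W] differs from the indicator
   of the ray only on [U] and [V] off the ray, where the masses are small. *)
pose W := U `&` V `&` [set z | all (fun y => (t < y) ==> (z < y))%O s].
have tW : nbhs t W.
  apply: filterI; first apply: filterI.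
  - by apply: open_nbhs_nbhs; split => //; apply: AU; rewrite /A /=.
  - by apply: open_nbhs_nbhs; split => //; apply: AV; rewrite /A /=.
  - elim: s {W} => [|y s IH]; first exact: filterS filterT.
    apply: filterS2 IH (_ : nbhs t [set z | (t < y) ==> (z < y)]%O).
      by move=> z /= -> ->.
    case: (boolP (t < y)%O) => ty; last by apply: filterS filterT => z.
    apply: filterS (_ : nbhs t `]-oo, y[%classic) => [z|].
      by rewrite /= in_itv.
    by apply: open_nbhs_nbhs; split; [exact: lray_open|rewrite /= in_itv].
have [f [[cf f01] f1 f0]] := right_step (R := R) hK _ _ tW.
exists f; split => //.
  move=> y ys ty; apply: f0 => // -[_ /allP /(_ y ys)].
  by rewrite ty ltxx.
have mS : measurable ((U `\` A) `&` (V `\` A) : set (borelK x0)).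
  by apply: measurableI; apply: measurableD => //; exact: open_borel.
apply: le_trans (Fdist_dist mup mun f t _ cf mS _) _.
  move=> x; case: (leP x t) => xt; first by rewrite f1// subrr normr0.
  rewrite subr0; have /andP[? ?] := f01 x; rewrite ger0_norm//.
  have [Wx|nW] := pselect (W x); last by rewrite (f0 x xt nW).
  have nA : ~ A x by rewrite /A /= leNgt xt.
  by rewrite indicE mem_set//; case: Wx => -[].
rewrite [leRHS]splitr; apply: lerD.
  apply: le_trans Ue; apply: fine_le; rewrite ?fin_num_measure//.
    by apply: measurableD => //; exact: open_borel.
  by apply: le_measure; rewrite ?inE//; apply: measurableD => //; exact: open_borel.
apply: le_trans Ve; apply: fine_le; rewrite ?fin_num_measure//.
  by apply: measurableD => //; exact: open_borel.
by apply: le_measure; rewrite ?inE//; apply: measurableD => //; exact: open_borel.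
Qed.

End borel.

(** * Sums of values of the distribution functions *)

Lemma sum_single_le (R : realType) (T : eqType) (s : seq T) (a : T -> R) (c : R) :
  0 <= c -> uniq s -> (forall t, t \in s -> `|a t| <= c) ->
  (forall t u, t \in s -> u \in s -> t != u -> a t = 0 \/ a u = 0) ->
  `|\sum_(t <- s) a t| <= c.
Proof.
move=> c0 us ac one; have [|] := boolP (has (fun t => a t != 0) s).
  move=> /hasP[t ts at0]; rewrite (bigD1_seq t)//= big_seq_cond big1 ?addr0 ?ac//.
  move=> u /andP[uS ut]; have [//|/eqP] := one _ _ uS ts ut.
  by rewrite (negPf at0).
move=> /hasPn a0; rewrite big_seq big1 ?normr0// => t /a0.
by rewrite negbK => /eqP.
Qed.

Lemma seq_min {d : Order.disp_t} {K : orderType d} (s : seq K) : s != [::] ->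
  exists2 y, y \in s & forall z, z \in s -> (y <= z)%O.
Proof.
elim: s => [//|a [_ _|b s /(_ isT)[y ys ymin] _]].
  by exists a => [|z]; rewrite ?mem_head// mem_seq1 => /eqP->.
case: (leP a y) => ay.
  exists a; rewrite ?mem_head// => z; rewrite in_cons => /predU1P[->//|/ymin].
  exact: le_trans.
exists y; first by rewrite in_cons ys orbT.
by move=> z; rewrite in_cons => /predU1P[->|/ymin//]; exact: ltW.
Qed.

Lemma seq_next {d : Order.disp_t} {K : orderType d} (s : seq K) (t : K) :
  (exists2 y, y \in s & (t < y)%O) ->
  exists y, [/\ y \in s, (t < y)%O & forall z, z \in s -> (t < z)%O -> (y <= z)%O].
Proof.
move=> [y ys ty]; have : [seq z <- s | (t < z)%O] != [::].
  by rewrite -has_filter; apply/hasP; exists y.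
move=> /seq_min[z]; rewrite mem_filter => /andP[tz zs] zmin.
by exists z; split => // u us tu; apply: zmin; rewrite mem_filter tu.
Qed.

(** * Bounded, pointwise null families of functionals on continuous functions *)

Section functionals.
Context {d : Order.disp_t} {K : orderTopologicalType d} {R : realType} {I : Type}.
Variables (hK : compact [set: K]) (L : I -> (K -> R) -> R) (F : I -> K -> R) (C : R).
Implicit Types (f g : K -> R) (i : I) (t x y : K) (X : set K).

Hypothesis C_ge0 : 0 <= C.
Hypothesis L_linear : forall i f g c, continuous f -> continuous g ->
  L i (fun x => f x + c * g x) = L i f + c * L i g.
Hypothesis L_bounded : forall i f, continuous f -> (forall x, `|f x| <= 1) ->
  `|L i f| <= C.
Hypothesis L_null : forall f, continuous f -> lim0 (fun i => L i f).
Hypothesis F_approx : forall i t (s : seq K) e, 0 < e ->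
  exists f, [/\ unit_fun f, one_upto f t,
    forall y, y \in s -> (t < y)%O -> zero_from f y & `|F i t - L i f| <= e].

Let continuousZD f g (c : R) : continuous f -> continuous g ->
  continuous (fun x => f x + c * g x).
Proof.
move=> cf cg x; apply: (@continuousD R R^o K f); first exact: cf.
by apply: (@continuousM R K (cst c) g); [exact: cvg_cst|exact: cg].
Qed.

Let L0 i : L i (fun=> 0) = 0.
Proof.
have : L i (fun=> 0) = L i (fun=> 0) + 1 * L i (fun=> 0).
  rewrite -L_linear; [|by move=> x; exact: cvg_cst..].
  by congr (L i _); apply/funext => x; rewrite mulr0 addr0.
by rewrite mul1r => /esym/(canRL (addrK _)); rewrite subrr.
Qed.

Lemma L_sum i (s : seq K) (c : K -> R) (g : K -> K -> R) :
  (forall t, t \in s -> continuous (g t)) ->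
  continuous (fun x => \sum_(t <- s) c t * g t x) /\
  L i (fun x => \sum_(t <- s) c t * g t x) = \sum_(t <- s) c t * L i (g t).
Proof.
elim: s => [_|t s IH cg].
  rewrite (_ : (fun _ => _) = fun=> 0); last by apply/funext => x; rewrite big_nil.
  by rewrite big_nil L0; split => // x; exact: cvg_cst.
have [cS LS] := IH (fun u us => cg u (mem_behead (s := t :: s) us)).
have ct := cg t (mem_head _ _).
rewrite (_ : (fun _ => _) = fun x => (\sum_(u <- s) c u * g u x) + c t * g t x).
  by split; [exact: continuousZD|rewrite L_linear// LS big_cons addrC].
by apply/funext => x; rewrite big_cons addrC.
Qed.

(* Replacing [F i t] by [L i (h t)] with [h t] a steeper step than [phi t], the
   differences [h t - phi t] have disjoint supports, located between [t] and the
   next point of [s]. *)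
Lemma sum_F_le i (s : seq K) (phi : K -> K -> R) : uniq s ->
  (forall t, t \in s -> [/\ unit_fun (phi t), one_upto (phi t) t &
    forall y, y \in s -> (t < y)%O -> zero_from (phi t) y]) ->
  \sum_(t <- s) `|F i t| <= C + \sum_(t <- s) `|L i (phi t)|.
Proof.
move=> us hphi; apply/ler_addgt0Pr => e e0.
pose e' := e / (size s).+1%:R.
have e'0 : 0 < e' by rewrite divr_gt0// ltr0n.
have /choice[h hP] := fun t => F_approx i t s e' e'0.
pose g t x := h t x + (-1) * phi t x.
have cg t : t \in s -> continuous (g t).
  by move=> ts; apply: continuousZD; [have [[]] := hP t|have [[]] := hphi t ts].
have gE t x : g t x = h t x - phi t x by rewrite /g mulN1r.
have g_low t x : t \in s -> (x <= t)%O -> g t x = 0.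
  move=> ts xt; rewrite gE; have [_ h1 _ _] := hP t; have [_ p1 _] := hphi t ts.
  by rewrite h1// p1// subrr.
have g_high t y x : t \in s -> y \in s -> (t < y)%O -> (y <= x)%O -> g t x = 0.
  move=> ts ys ty yx; rewrite gE; have [_ _ h0 _] := hP t.
  have [_ _ p0] := hphi t ts.
  by rewrite (h0 _ ys ty _ yx) (p0 _ ys ty _ yx) subrr.
have g1 t x : t \in s -> `|g t x| <= 1.
  move=> ts; rewrite gE; have [[_ /(_ x)/andP[? ?]] _ _ _] := hP t.
  have [[_ /(_ x)/andP[? ?]] _ _] := hphi t ts.
  by rewrite ler_norml; apply/andP; split; lra.
(* With these signs the sum of [|L i (g t)|] becomes the value of [L i] at a single function. At
   each point at most one [g t] is nonzero, so this function lies in the unit ball and the value is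
   at most [C]. *)
pose sg t := Num.sg (L i (g t)).
have [cS LS] := L_sum i s sg g cg.
have sumLg : \sum_(t <- s) `|L i (g t)| <= C.
  rewrite (eq_bigr (fun t => sg t * L i (g t))) => [|t _]; last by rewrite /sg -normrEsg.
  rewrite -LS (le_trans (ler_norm _))// L_bounded// => x.
  apply: sum_single_le => // [t ts|t u ts us' tu].
    rewrite normrM (le_trans _ (g1 t x ts))// ler_piMl//.
    by rewrite /sg normr_sg; case: (_ != 0).
  wlog ltu : t u ts us' tu / (t < u)%O.
    move=> wl; have [tu'|ut] := orP (lt_total tu); first exact: wl.
    by rewrite or_comm; apply: wl => //; rewrite eq_sym.
  case: (leP x u) => xu; first by right; rewrite g_low// mulr0.
  by left; rewrite (g_high t u)// ?mulr0// ltW.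
have Ft t : t \in s -> `|F i t| <= `|L i (phi t)| + `|L i (g t)| + e'.
  move=> ts; have [[ch _] _ _ Fh] := hP t; have [[cp _] _ _] := hphi t ts.
  have Lg : L i (g t) = L i (h t) - L i (phi t) by rewrite L_linear// mulN1r.
  have -> : F i t = L i (phi t) + L i (g t) + (F i t - L i (h t)) by rewrite Lg; ring.
  by rewrite (le_trans (ler_normD _ _))// lerD// ler_normD.
apply: (@le_trans _ _ (\sum_(t <- s) (`|L i (phi t)| + `|L i (g t)| + e'))).
  by rewrite big_seq [leRHS]big_seq; exact: ler_sum.
rewrite 2!big_split/= [\sum_(t <- s) `|L i (phi t)| + _]addrC lerD//.
  by rewrite lerD2r.
rewrite big_const_seq count_predT iter_addr addr0 -mulr_natl.
by rewrite /e' mulrCA ger_pMr// ler_pdivrMr ?ltr0n// mul1r ler_nat.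
Qed.

(** For [phi t], take the annihilated step from [t] to the next point of [s]; the last point has
    none and gets the constant 1. Only this constant contributes to the sum of [|L i (phi t)|], and
    by at most [C]. *)
Lemma sum_F_le_annihilated i (s : seq K) : uniq s ->
  (forall x y, x \in s -> y \in s -> (x < y)%O ->
    exists f, [/\ unit_fun f, one_upto f x, zero_from f y & L i f = 0]) ->
  \sum_(t <- s) `|F i t| <= 2 * C.
Proof.
move=> us hs.
have /choice[phi phiP] : forall t, exists f, t \in s -> [/\ unit_fun f, one_upto f t,
    forall y, y \in s -> (t < y)%O -> zero_from f y &
    (exists2 y, y \in s & (t < y)%O) -> L i f = 0].
  move=> t; have [ts|] := boolP (t \in s); last by exists (fun=> 0).
  have [/seq_next[y [ys ty ymin]]|nex] := pselect (exists2 y, y \in s & (t < y)%O).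
    have [f [uf f1 f0 Lf]] := hs _ _ ts ys ty.
    exists f => _; split => // z zs tz u zu.
    by apply: f0; apply: le_trans zu; exact: ymin.
  exists (fun=> 1) => _; split => //; first by apply: unit_fun_cst; rewrite lexx ler01.
  by move=> y ys ty; case: nex; exists y.
have hphi t (ts : t \in s) : [/\ unit_fun (phi t), one_upto (phi t) t &
    forall y, y \in s -> (t < y)%O -> zero_from (phi t) y] by have [] := phiP t ts.
apply: le_trans (sum_F_le i s phi us hphi) _.
rewrite mulr_natl mulr2n lerD2l; rewrite -[leLHS]ger0_norm ?sumr_ge0//.
apply: sum_single_le => // [t /phiP[[cf f01] _ _ _]|t u ts us' tu].
  rewrite normr_id L_bounded// => x.
  by have /andP[? ?] := f01 x; rewrite ger0_norm.
wlog ltu : t u ts us' tu / (t < u)%O.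
  move=> wl; have [tu'|ut] := orP (lt_total tu); first exact: wl.
  by rewrite or_comm; apply: wl => //; rewrite eq_sym.
by left; have [_ _ _ ->] := phiP t ts; rewrite ?normr0//; exists u.
Qed.

Lemma step_avoiding (s : seq K) t : exists f, [/\ unit_fun f, one_upto f t &
  forall y, y \in s -> (t < y)%O -> zero_from f y].
Proof.
have [/seq_next[y [ys ty ymin]]|nex] := pselect (exists2 y, y \in s & (t < y)%O).
  have [f [uf f1 f0]] := step_exists (R := R) hK _ _ ty.
  exists f; split => // z zs tz u zu.
  by apply: f0; apply: le_trans zu; exact: ymin.
exists (fun=> 1); split => //; first by apply: unit_fun_cst; rewrite lexx ler01.
by move=> y ys ty; case: nex; exists y.
Qed.

Lemma countable_block X : countable X -> exists S : I -> set K,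
  (forall t, X t -> finite_set [set i | ~ S i t]) /\
  forall i (s : seq K), uniq s -> (forall t, t \in s -> X t /\ S i t) ->
    \sum_(t <- s) `|F i t| <= C + 1.
Proof.
move=> /countable_injP[/= e einj].
have /choice[P PP] : forall n, exists s : seq K, forall t, t \in s <-> X t /\ (e t < n)%N.
  elim=> [|n [s sP]]; first by exists [::] => t; split => // -[].
  have ltS m : (m < n.+1)%N = (m == n) || (m < n)%N by rewrite ltnS leq_eqVlt.
  have [[u [Xu eu]]|nex] := pselect (exists u, X u /\ e u = n).
    exists (u :: s) => t; rewrite in_cons ltS; split.
      by move=> /predU1P[->|/sP[? ->]]; rewrite ?eu ?eqxx ?orbT.
    move=> [Xt /predU1P[etn|etn]]; last by apply/orP; right; apply/sP.
    by rewrite (einj t u) ?inE ?eqxx// etn.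
  exists s => t; rewrite sP ltS; split => [[? ->]|]; first by rewrite orbT.
  by move=> [Xt /predU1P[etn|->//]]; case: nex; exists t.
have /choice[phi phiP] := fun nt : nat * K => step_avoiding (P nt.1) nt.2.
pose c n : R := (size (P n)).+1%:R^-1.
have c0 n : 0 < c n by rewrite invr_gt0 ltr0n.
pose G n := [set i | forall t, t \in P n -> `|L i (phi (n, t))| < c n].
have finG n : finite_set (~` G n).
  apply: (@sub_finite_set _ _
    (\bigcup_(t in [set` P n]) [set i | c n <= `|L i (phi (n, t))|])).
    move=> i /existsNP[t /not_implyP[tP /negP]]; rewrite -leNgt => h.
    by exists t.
  apply: bigcup_finite => // t tP; apply: L_null => //.
  by have [[]] := phiP (n, t).
exists (fun i => [set t | forall m, (m <= (e t).+1)%N -> G m i]); split.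
  move=> t Xt; apply: (@sub_finite_set _ _ (\bigcup_(n in `I_(e t).+2) ~` G n)).
    by move=> i /= /existsNP[m /not_implyP[me nG]]; exists m.
  exact: bigcup_finite.
move=> i s us sX.
(* The point of [s] with the largest number supplies a stage that [i] passes and whose list contains
   all of [s]. *)
have [n [Gn sn]] : exists n, G n i /\ forall t, t \in s -> (e t < n)%N.
  elim: s us sX => [_ _|t s IH /andP[_ us] sX].
    by exists 0%N; split => // t /PP[].
  have [_ Gt] := sX t (mem_head _ _).
  have [//|u us'|n [Gn sn]] := IH; first by apply: sX; rewrite in_cons us' orbT.
  have [nt|tn] := leqP n (e t).+1.
    exists (e t).+1; split; [exact: Gt|move=> u; rewrite in_cons => /predU1P[->//|/sn un]].
    exact: leq_trans un nt.
  by exists n; split => // u; rewrite in_cons => /predU1P[->|/sn//]; exact: ltnW.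
have sP t : t \in s -> t \in P n.
  by move=> ts; apply/PP; split; [have [] := sX t ts|exact: sn].
apply: le_trans (sum_F_le i s (fun t => phi (n, t)) us _) _.
  move=> t ts; have [uf f1 f0] := phiP (n, t); split => // y ys.
  by apply: f0; exact: sP.
(* [s] has at most [size (P n)] elements, each contributing at most [c n], so the total is at most
   1. *)
rewrite lerD2l; apply: (@le_trans _ _ (\sum_(t <- s) c n)).
  by rewrite big_seq [leRHS]big_seq; apply: ler_sum => t /sP/Gn/ltW.
rewrite big_const_seq count_predT iter_addr addr0 -mulr_natl.
rewrite ler_pdivrMr ?ltr0n// mul1r ler_nat ltnW// ltnS.
by apply: uniq_leq_size.
Qed.

(** * Exceptional sets and saturated sets *)

Hypothesis F_interval : forall i, exists G : K -> R,
  [/\ forall t, 0 <= G t,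
   forall x y f, (x <= y)%O -> unit_fun f -> one_upto f x -> zero_from f y ->
    `|F i x - L i f| <= G y - G x &
   forall x y f, (x <= y)%O -> unit_fun f -> one_upto f x -> zero_from f y ->
    `|F i y - L i f| <= G y - G x].

(* Points of [B i] whose values of [G] fall into the same interval of length
   [(n + 1)^-1], and where [|F i|] exceeds twice this length, belong to the
   neighbourhoods [V] of each other. *)
Lemma exceptional_sets (Q : set K) (V : K -> set K) : countably_separating_on Q V ->
  exists B : I -> set K, (forall i, B i `<=` Q /\ countable (B i)) /\
    forall t e, Q t -> 0 < e -> finite_set [set i | ~ B i t /\ e <= `|F i t|].
Proof.
move=> [VQ Vclique].
have /choice[W WP] : forall t, exists W, Q t -> nbhs t W /\ W `&` Q `<=` V t.
  move=> t; have [Qt|] := pselect (Q t); last by exists set0.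
  by have [_ [W hW]] := VQ t Qt; exists W.
have /choice[l lP] : forall t, exists f, Q t -> [/\ unit_fun f, zero_from f t &
    forall y, (y < t)%O -> ~ W t y -> one_upto f y].
  move=> t; have [Qt|] := pselect (Q t); last by exists (fun=> 0).
  by have [/(left_step (R := R) hK)[f hf] _] := WP t Qt; exists f.
have /choice[r rP] : forall t, exists f, Q t -> [/\ unit_fun f, one_upto f t &
    forall y, (t < y)%O -> ~ W t y -> zero_from f y].
  move=> t; have [Qt|] := pselect (Q t); last by exists (fun=> 0).
  by have [/(right_step (R := R) hK)[f hf] _] := WP t Qt; exists f.
(* If [t] is not in [B i] and [|F i t|] is at least [e], one of the two integrals is at least
   [e / 2] in size. This happens for finitely many [i], since [L] is null at the fixed functions
   [l t] and [r t]. *)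
exists (fun i => [set t | [/\ Q t, `|L i (l t)| < `|F i t| / 2 &
  `|L i (r t)| < `|F i t| / 2]]).
split; last first.
  move=> t e Qt e0; have e2 : 0 < e / 2 by rewrite divr_gt0.
  have [[cl _] _ _] := lP t Qt; have [[cr _] _ _] := rP t Qt.
  have := L_null _ cl _ e2; have := L_null _ cr _ e2 => fr fl.
  apply: (sub_finite_set _ (_ : finite_set (_ `|` _))); last first.
    by rewrite finite_setU; split; [exact: fl|exact: fr].
  move=> i /= [nB eF]; rewrite leNgt [in X in _ \/ X]leNgt.
  apply: contrapT => /not_orP[/negP + /negP]; rewrite !negbK => le re.
  by apply: nB; split => //; [apply: lt_le_trans le _|apply: lt_le_trans re _]; rewrite ler_pM2r.
move=> i; split => [t []//|].
have [G [G0 Gl Gr]] := F_interval i.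
set B := [set t | _].
pose M (p : nat * nat) := B `&` [set t | 2 / p.1.+1%:R <= `|F i t| /\
  Num.truncn (G t * p.1.+1%:R) = p.2].
apply: (@sub_countable _ _ _ (\bigcup_(p in [set: nat * nat]) M p)); last first.
  apply: bigcup_countable => // -[n k] _; apply: Vclique; first by move=> t [[]].
  have near x y : M (n, k) x -> M (n, k) y -> G x - G y < n.+1%:R^-1.
    move=> [_ /= [_ xk]] [_ /= [_ yk]].
    have n0 : 0 < n.+1%:R :> R by rewrite ltr0n.
    have /truncn_itv/andP[_] : 0 <= G x * n.+1%:R by rewrite mulr_ge0// ltW.
    have /truncn_itv/andP[+ _] : 0 <= G y * n.+1%:R by rewrite mulr_ge0// ltW.
    rewrite xk yk -[k.+1%:R]natr1 => ? ?.
    by rewrite -[ltRHS]mul1r ltr_pdivlMr// mulrBl; lra.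
  move=> x y Mx My; have [[Qx _ _] _] := Mx.
  have [[Qy ly ry] [/= Fy _]] := My.
  have [nW WV] := WP y Qy; apply: WV; split => //.
  (* Such an integral is far from [F i y]. Were [x] outside [W y], then [l y] or [r y] would be a
     step between [x] and [y], and the closeness of [G x] and [G y] would force the opposite. *)
  have small f : `|L i f| < `|F i y| / 2 -> ~ `|F i y - L i f| < n.+1%:R^-1.
    move: Fy; set c := n.+1%:R^-1; have := lerB_dist (F i y) (L i f) => ? ? ? ?; lra.
  have [xy|yx|xy] := ltgtP x y.
  - apply: contrapT => nWx; have [ul l0 l1] := lP y Qy.
    apply: (small _ ly); apply: le_lt_trans (near _ _ My Mx).
    by apply: Gr => //; [exact: ltW|exact: l1].
  - apply: contrapT => nWx; have [ur r1 r0] := rP y Qy.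
    apply: (small _ ry); apply: le_lt_trans (near _ _ Mx My).
    by apply: Gl => //; [exact: ltW|exact: r0].
  - by rewrite xy; exact: nbhs_singleton.
apply: subset_card_le => t Bt.
have Ft : 0 < `|F i t| by have [_ h _] := Bt; have := normr_ge0 (L i (l t)); lra.
pose n := Num.truncn (2 / `|F i t|).
exists (n, Num.truncn (G t * n.+1%:R)) => //.
split => //=; split => //.
by rewrite ler_pdivrMr ?ltr0n// mulrC -ler_pdivrMr// ltW// truncnS_gt.
Qed.

Section saturation.
Variable B : I -> set K.

(** The last clause is the contrapositive form of annihilation by every [L i] with [B i] not
    included in [X]. *)
Definition saturated X := forall x y, X x -> X y -> (x < y)%O ->
  exists f, [/\ unit_fun f, one_upto f x, zero_from f y &
    forall i, L i f <> 0 -> B i `<=` X].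

(** For each [n], only finitely many [i] have [|L i f|] at least [n.+1%:R^-1]. *)
Lemma countable_nonnull f : continuous f -> countable [set i | L i f <> 0].
Proof.
move=> cf.
apply: (@sub_countable _ _ _
    (\bigcup_(n in [set: nat]) [set i | n.+1%:R^-1 <= `|L i f|])); last first.
  apply: bigcup_countable => // n _; apply: finite_set_countable.
  by apply: L_null => //; rewrite invr_gt0 ltr0n.
apply: subset_card_le => i /= /eqP; rewrite -normr_gt0 => Lf.
exists (Num.truncn (`|L i f|^-1)) => //=.
by rewrite -[leRHS]invrK lef_pV2 ?posrE ?invr_gt0 ?ltr0n// ltW// truncnS_gt.
Qed.

(* When [X] is saturated, separating a new point [t] from all points of [X] only
   takes the steps between [t] and its neighbours in [X]: if, say, [X] has no
   last point below [t], then the points of [X] below [t] are separated from [t]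
   by the steps already associated with pairs of [X]. *)
Lemma saturated_extension X t : (forall i, countable (B i)) -> saturated X ->
  exists X', [/\ saturated X', X `<=` X', X' t, countable (X' `\` X) &
    X' `<=` X `|` [set t] `|` \bigcup_i B i].
Proof.
move=> Bc satX.
have /choice[phi phiP] : forall p : K * K, exists f, (p.1 < p.2)%O ->
    [/\ unit_fun f, one_upto f p.1 & zero_from f p.2].
  move=> [x y] /=; case: (ltP x y) => xy; last by exists (fun=> 0).
  by have [f hf] := step_exists (R := R) hK _ _ xy; exists f.
(* The immediate neighbours of [u] in [X], encoded as sets with at most one point, empty when there
   is no such neighbour. *)
pose pr u := [set x | [/\ X x, (x < u)%O & forall z, X z -> (z < u)%O -> (z <= x)%O]].
pose su u := [set x | [/\ X x, (u < x)%O & forall z, X z -> (u < z)%O -> (x <= z)%O]].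
have prc u : countable (pr u).
  have [[x px]|nx] := pselect (exists x, pr u x); last first.
    by rewrite (_ : pr u = set0)// -subset0 => x px; apply: nx; exists x.
  apply: sub_countable (countable1 x); apply: subset_card_le => y [Xy yu ymax].
  by have [Xx xu xmax] := px; apply/eqP; rewrite eq_le xmax// ymax.
have suc u : countable (su u).
  have [[x px]|nx] := pselect (exists x, su u x); last first.
    by rewrite (_ : su u = set0)// -subset0 => x px; apply: nx; exists x.
  apply: sub_countable (countable1 x); apply: subset_card_le => y [Xy yu ymin].
  by have [Xx xu xmin] := px; apply/eqP; rewrite eq_le xmin// ymin.
pose nb D := \bigcup_(u in D) ([set u] `|` pr u `|` su u).
have nbc D : countable D -> countable (nb D).
  move=> Dc; apply: bigcup_countable => // u _.
  by rewrite -!bigcup2E; do 2! (apply: bigcup_countable => // -[|[|n]] _ //=); exact: countable1.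
have nbS D E : D `<=` E -> nb D `<=` nb E by move=> DE; exact: bigcup_subset.
(* One round of closure: for all pairs from [D] and its neighbours in [X], add the sets [B i] of the
   countably many [i] not annihilating the chosen step. The union [DD] of all rounds is closed under
   this operation. *)
pose step D := D `|` \bigcup_(p in [set p | nb D p.1 /\ nb D p.2 /\ (p.1 < p.2)%O])
  \bigcup_(i in [set i | L i (phi p) <> 0]) B i.
have stepc D : countable D -> countable (step D).
  move=> Dc; rewrite /step -bigcup2E; apply: bigcup_countable => // -[|[|n]] _ //=.
  apply: bigcup_countable => [|p [_ [_ plt]]].
    apply: sub_countable (countableX (nbc _ Dc) (nbc _ Dc)).
    by apply: subset_card_le => p [? [? _]].
  apply: bigcup_countable => [|i _]; last exact: Bc.
  by apply: countable_nonnull; have [[]] := phiP p plt.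
pose D n := iter n step [set t].
have Dc n : countable (D n) by elim: n => [|n IH]; [exact: countable1|exact: stepc].
have DS m n : (m <= n)%N -> D m `<=` D n.
  move=> /subnK <-; elim: (n - m)%N => [//|k IH] u /IH Du; left; exact: Du.
pose DD := \bigcup_n D n.
have phiD x y : nb DD x -> nb DD y -> (x < y)%O ->
    forall i, L i (phi (x, y)) <> 0 -> B i `<=` DD.
  move=> [u [m _ Du] xu] [v [n _ Dv] yv] xy i Li z Bz.
  exists (maxn m n).+1 => //; right; exists (x, y); last by exists i.
  split; first by exists u => //; apply: DS Du; exact: leq_maxl.
  by split => //; exists v => //; apply: DS Dv; exact: leq_maxr.
have nbDD u : DD u -> nb DD u by move=> Du; exists u => //; left; left.
have Dt : DD t by exists 0%N.
exists (X `|` DD); split.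
- move=> x y [Xx|Dx] [Xy|Dy] xy.
  + have [f [uf f1 f0 fB]] := satX _ _ Xx Xy xy.
    by exists f; split => // i /fB BX z /BX; left.
  (* If [y] has a predecessor [m] in [X], then [x <= m] and the step chosen for [(m, y)] separates.
     Otherwise some [z] of [X] lies strictly between [x] and [y], and the step that saturation gives
     for [x] and [z] separates. The next case is symmetric. *)
  + have [[m pm]|nm] := pselect (exists m, pr y m).
      have [Xm my mmax] := pm.
      have [uf f1 f0] := phiP (m, y) my.
      exists (phi (m, y)); split => // [z zx|i Li z Bz].
        by apply: f1; rewrite /= (le_trans zx)// mmax.
      right; apply: (phiD m y _ _ my i Li) => //; last exact: nbDD.
      by exists y => //; left; right.
    have [z [Xz zy xz]] : exists z, [/\ X z, (z < y)%O & (x < z)%O].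
      apply: contrapT => h; apply: nm; exists x; split => // z Xz zy.
      by rewrite leNgt; apply/negP => xz; apply: h; exists z.
    have [f [uf f1 f0 fB]] := satX _ _ Xx Xz xz.
    exists f; split => // [u yu|i /fB BX u /BX]; last by left.
    by apply: f0; exact: le_trans (ltW zy) yu.
  + have [[m pm]|nm] := pselect (exists m, su x m).
      have [Xm xm mmin] := pm.
      have [uf f1 f0] := phiP (x, m) xm.
      exists (phi (x, m)); split => // [z yz|i Li z Bz].
        by apply: f0; rewrite /= (le_trans _ yz)// mmin.
      right; apply: (phiD x m _ _ xm i Li) => //; first exact: nbDD.
      by exists x => //; right.
    have [z [Xz xz zy]] : exists z, [/\ X z, (x < z)%O & (z < y)%O].
      apply: contrapT => h; apply: nm; exists y; split => // z Xz xz.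
      by rewrite leNgt; apply/negP => zy; apply: h; exists z.
    have [f [uf f1 f0 fB]] := satX _ _ Xz Xy zy.
    exists f; split => // [u ux|i /fB BX u /BX]; last by left.
    by apply: f1; exact: le_trans ux (ltW xz).
  + have [uf f1 f0] := phiP (x, y) xy.
    exists (phi (x, y)); split => // i Li z Bz; right.
    by apply: (phiD x y _ _ xy i Li) => //; exact: nbDD.
- by move=> x Xx; left.
- by right.
- apply: (@sub_countable _ _ _ DD); last exact: bigcup_countable.
  by apply: subset_card_le => x [[|]].
- move=> x [Xx|[n _]]; first by left; left.
  elim: n x => [x <-|n IH x [/IH//|[p _ [i _ Bx]]]]; first by left; right.
  by right; exists i.
Qed.

(** * Extending the decomposition *)

(** [S i t] marks the values [F i t] that go into the summable part; the unmarked ones must tend to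
    0 at each [t]. *)
Definition controlled (Q : set K) (S : I -> set K) :=
  (forall t e, Q t -> 0 < e -> finite_set [set i | ~ S i t /\ e <= `|F i t|]) /\
  forall i (s : seq K), uniq s -> (forall t, t \in s -> Q t /\ S i t) ->
    \sum_(t <- s) `|F i t| <= 3 * C + 1.

(** [S] is kept on [X]. At a new point, an index with [B i] inside [X] is left unmarked, as the
    point lies outside [B i]; every other index follows the diagonal choice [SP]. *)
Lemma controlled_extension X X' S :
  (forall t e, X' t -> 0 < e -> finite_set [set i | ~ B i t /\ e <= `|F i t|]) ->
  saturated X -> X `<=` X' -> countable (X' `\` X) -> controlled X S ->
  exists S', controlled X' S' /\ forall i t, X t -> S' i t <-> S i t.
Proof.
move=> Bfin satX XX' Pc [Sfin Ssum].
have [SP [SPfin SPsum]] := countable_block _ Pc.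
exists (fun i => [set t | (X t /\ S i t) \/ [/\ ~ X t, ~ (B i `<=` X) & SP i t]]).
split; last first.
  by move=> i t Xt; split => [[[]//|[]//]|St]; left.
split.
  move=> t e X't e0; have [Xt|nXt] := pselect (X t).
    apply: sub_finite_set (Sfin t e Xt e0) => i /= [nS eF]; split => // St.
    by apply: nS; left.
  apply: (@sub_finite_set _ _ ([set i | ~ B i t /\ e <= `|F i t|] `|` [set i | ~ SP i t])).
    move=> i /= [nS eF]; have [BX|nBX] := pselect (B i `<=` X).
      by left; split => // /BX.
    by right => SPt; apply: nS; right.
  by rewrite finite_setU; split; [exact: Bfin|exact: SPfin].
move=> i s us sS; have [BX|nBX] := pselect (B i `<=` X).
  by apply: Ssum => // t /sS[_ [//|[_ /(_ BX)]]].
rewrite (bigID (fun t => `[< X t >]))/= -big_filter -[X in _ + X]big_filter.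
(* Here [B i] is not inside [X], so [L i] annihilates the separating steps of [X]: the points of [X]
   cost [2 * C] whatever [S] was, and the new points cost [C + 1]. The bound therefore does not grow
   with repeated extension. *)
have -> : 3 * C + 1 = 2 * C + (C + 1) by ring.
apply: lerD.
  apply: sum_F_le_annihilated; first exact: filter_uniq.
  move=> x y; rewrite !mem_filter => /andP[/asboolP Xx _] /andP[/asboolP Xy _] xy.
  have [f [uf f1 f0 fB]] := satX _ _ Xx Xy xy; exists f; split => //.
  by apply: contrapT => /fB.
apply: SPsum; first exact: filter_uniq.
move=> t; rewrite mem_filter => /andP[/asboolP nX /sS[X't [[]//|[]//]]].
Qed.

Lemma controlled_exists (Q : set K) :
  (forall i, B i `<=` Q /\ countable (B i)) ->
  (forall t e, Q t -> 0 < e -> finite_set [set i | ~ B i t /\ e <= `|F i t|]) ->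
  exists S, controlled Q S.
Proof.
move=> BQ Bfin.
pose good (p : set K * (I -> set K)) := [/\ saturated p.1, p.1 `<=` Q & controlled p.1 p.2].
(* The order for Zorn's lemma: a larger pair may not alter the marking on the smaller set. *)
pose ext (p q : {p | good p}) := `[< (sval p).1 `<=` (sval q).1 /\
  forall i t, (sval p).1 t -> (sval q).2 i t <-> (sval p).2 i t >].
have good0 : good (set0, fun=> set0).
  split => //; split => // i [|t s] us sS; first by rewrite big_nil addr_ge0 ?mulr_ge0.
  by have [] := sS t (mem_head _ _).
have [| | |[[X S] [satX XQ cS]] maxX] := @ZL_preorder {p | good p} (exist _ _ good0) ext.
- by move=> p; apply/asboolP; split.
- move=> q p r /asboolP[qp qpS] /asboolP[pr prS]; apply/asboolP; split.
    exact: subset_trans pr.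
  by move=> i t qt; rewrite prS ?qpS//; exact: qp.
- move=> A Atot.
  pose X := \bigcup_(p in A) (sval p).1.
  pose S i := [set t | exists p, [/\ A p, (sval p).1 t & (sval p).2 i t]].
  have SE p i t : A p -> (sval p).1 t -> S i t <-> (sval p).2 i t.
    move=> Ap pt; split => [[q [Aq qt qS]]|pS]; last by exists p.
    have [/asboolP[_ h]|/asboolP[_ h]] := Atot p q Ap Aq; first by rewrite -h.
    by rewrite h.
  (* Both saturation and the bound on sums concern finitely many points at a time, and these lie in
     one member of the chain. The list is nonempty because an empty one would not supply a
     member. *)
  have common s t0 : (forall t, t \in t0 :: s -> X t) ->
      exists2 p, A p & forall t, t \in t0 :: s -> (sval p).1 t.
    elim: s => [|t s IH] Xs.
      have [p Ap pt] := Xs t0 (mem_head _ _).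
      by exists p => // t; rewrite mem_seq1 => /eqP->.
    have [|p Ap ps] := IH.
      move=> u; rewrite in_cons => /predU1P[->|us]; apply: Xs.
        by rewrite mem_head.
      by rewrite !in_cons us !orbT.
    have [|q Aq qt] := Xs t; first by rewrite !in_cons eqxx orbT.
    have [/asboolP[pq _]|/asboolP[qp _]] := Atot p q Ap Aq.
      exists q => // u; rewrite !in_cons => /or3P[/eqP->|/eqP->//|us]; apply: pq; apply: ps.
        by rewrite mem_head.
      by rewrite in_cons us orbT.
    exists p => // u; rewrite !in_cons => /or3P[/eqP->|/eqP->|us].
    - by apply: ps; rewrite mem_head.
    - exact: qp.
    - by apply: ps; rewrite in_cons us orbT.
  have goodXS : good (X, S).
    split => /=.
    - move=> x y Xx Xy xy.
      have [|p Ap pP] := common [:: y] x.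
        by move=> z; rewrite !in_cons in_nil orbF => /orP[/eqP->|/eqP->].
      have [satp _ _] := svalP p.
      have [|| f [uf f1 f0 fB]] := satp x y _ _ xy; [by apply: pP; rewrite !in_cons eqxx ?orbT..|].
      by exists f; split => // i /fB Bp z /Bp; exists p.
    - by move=> t [p Ap]; have [_ + _] := svalP p; exact.
    - split.
        move=> t e [p Ap pt] e0; have [_ _ [pfin _]] := svalP p.
        by apply: sub_finite_set (pfin t e pt e0) => i /= []; rewrite (SE p).
      move=> i [|t s] us sS; first by rewrite big_nil addr_ge0 ?mulr_ge0.
      have [u us'|p Ap pP] := common s t; first by have [] := sS u us'.
      have [_ _ [_ psum]] := svalP p; apply: psum => // u us'.
      by have pu := pP u us'; split => //; apply/(SE p) => //; have [] := sS u us'.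
  exists (exist _ _ goodXS) => p Ap; apply/asboolP; split; first by move=> t pt; exists p.
  by move=> i t pt; exact: SE.
exists S; suff -> : Q = X by [].
apply/seteqP; split => // t Qt; apply: contrapT => nXt.
(* A point [t] of [Q] outside [X] would give a good pair strictly above the maximal one. *)
have [X' [satX' XX' X't X'Xc X'sub]] := saturated_extension X t (fun i => (BQ i).2) satX.
have X'Q : X' `<=` Q.
  by move=> u /X'sub[[/XQ//|->//]|[i _ /(BQ i).1]].
have [|S' [cS' S'S]] := controlled_extension X X' S _ satX XX' X'Xc cS.
  by move=> u e /X'Q; exact: Bfin.
have good' : good (X', S') by [].
have /asboolP[/= X'X _] : ext (exist _ _ good') (exist _ (X, S) (And3 satX XQ cS)).
  by apply: maxX; apply/asboolP.
by apply: nXt; exact: X'X.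
Qed.

End saturation.

End functionals.

(** * Passage from the functionals back to the measures *)

Theorem theorem4p9 (d : Order.disp_t) (K : orderTopologicalType d) (x0 : K) (R : realType)
  (hK : compact [set: K]) (Q : set K)
  (hQ : exists V : K -> set K, countably_separating_on Q V)
  (I : Type) (mup mun : I -> {finite_measure set (borelK x0) -> \bar R})
  (hreg : forall i, regular_measure (mup i) /\ regular_measure (mun i))
  (hnull : weak_star_null mup mun) :
  type_c0l1 Q (fun i => Fdist (mup i) (mun i)).
Proof.
have [V sepV] := hQ.
pose L i := Defs.sintegral (mup i) (mun i); pose F i := Fdist (mup i) (mun i).
have Llin i (f g : K -> R) (c : R) : continuous f -> continuous g ->
    L i (fun x => f x + c * g x) = L i f + c * L i g.
  exact: sintegral_linear.
(* Only finitely many indices have [|L i f|] at least 1; the sum of the values occurring there, plus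
   1, is a bound for all. *)
have Lpt (f : K -> R) : continuous f -> exists M, forall i, `|L i f| <= M.
  move=> cf; have : finite_set ((fun i => `|L i f|) @` [set i | 1 <= `|L i f|]).
    by apply: finite_image; apply: hnull.
  move=> /finite_seqP[s sE]; exists (\sum_(r <- s) `|r| + 1) => i.
  have s0 : 0 <= \sum_(r <- s) `|r| by rewrite sumr_ge0.
  case: (ltP `|L i f| 1) => Li; first by apply: ltW; lra.
  have : `|L i f| \in s by have : [set` s] `|L i f| by rewrite -sE; exists i.
  move=> /perm_to_rem/(perm_big (op := +%R) _)->/=; rewrite big_cons normr_id.
  have : 0 <= \sum_(r <- rem `|L i f| s) `|r| by rewrite sumr_ge0.
  lra.
have [C [C0 LC]] := uniform_boundedness I L Llin
  (fun i => sintegral_bounded x0 hK (mup i) (mun i)) Lpt.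
have Fapp i t (s : seq K) e (e0 : 0 < e) :=
  Fdist_approx_step x0 hK (mup i) (mun i) t s e (hreg i).1 (hreg i).2 e0.
have Fitv i := Fdist_approx_interval x0 (mup i) (mun i).
have [B [BQ Bfin]] := exceptional_sets hK L F hnull Fitv Q V sepV.
have [S [Sfin Ssum]] := controlled_exists hK L F C C0 Llin LC hnull Fapp B Q BQ Bfin.
exists (fun i t => if `[< S i t >] then 0 else F i t).
exists (fun i t => if `[< S i t >] then F i t else 0).
split; first by move=> i t _; case: ifP => _; rewrite ?add0r ?addr0.
split.
  move=> t Qt e e0; apply: sub_finite_set (Sfin t e Qt e0) => i /=.
  by case: asboolP => // _; rewrite normr0 leNgt e0.
(* The sum over [Q] is the supremum of its finite subsums. In each of them only the marked points
   count, and the bound for finite lists applies. *)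
exists (3 * C + 1) => i; apply: ge_ereal_sup => _ [A [finA AQ] <-].
rewrite fsbig_finite//= sumEFin lee_fin.
rewrite (eq_bigr (fun t => if `[< S i t >] then `|F i t| else 0)); last first.
  by move=> t _; case: ifP; rewrite ?normr0.
rewrite -big_mkcond -big_filter; apply: Ssum; first by rewrite filter_uniq ?finmap.fset_uniq.
move=> t; rewrite mem_filter in_fset_set// => /andP[/asboolP St /set_mem At].
by split => //; exact: AQ.
Qed.
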